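(* Let $G=(V,E)$ be a finite graph (undirected or directed, without loops) with $V=\{1,\dots,n\}$, and let $\mathcal C$ be a storage code on $G$ over a finite alphabet $Q$, $|Q|=q\ge 2$, with $\mathcal R_q(\mathcal C)=\mathsf{cap}_q(G)$. Fix a proper coloring of $G$ and, for each color, a matrix from a family of orthogonal partitions of shape $(k,s)$ (distinct colors receiving distinct matrices), and let $\bar G$ and $\bar{\mathcal C}$ be the resulting interleaved graph and interleaved code. If $\mathsf{cap}_q(G)=1-\delta(G)/n$, then the interleaved code $\bar{\mathcal C}$ achieves the maximum rate on $\bar G$, i.e. $\mathcal R_{q^k}(\bar{\mathcal C})=\mathsf{cap}(\bar G)$, and $\mathsf{cap}_{q^k}(\bar G)=\mathsf{cap}(G)$.
   Context: Storage codes: for a finite graph $G=(V,E)$ with $|V|=n$ put $N(v)=\{u:(v,u)\in E\}$. A storage code on $G$ over an alphabet $Q$ of size $q$ is a nonempty set $\mathcal C\subseteq Q^V$ such that for each $v\in V$ there is a function $f_v$ with $x_v=f_v((x_u)_{u\in N(v)})$ for all $x\in\mathcal C$. Its rate is $\mathcal R_q(\mathcal C)=\frac1n\log_q|\mathcal C|$; $\mathsf{cap}_q(G)$ is the largest rate of a storage code on $G$ over an alphabet of size $q$, and $\mathsf{cap}(G)=\sup_{q\ge2}\mathsf{cap}_q(G)$. DAG sets: $S\subseteq V$ is a DAG set if the subgraph induced by $S$ contains no directed cycles (an undirected edge is regarded as a pair of opposite arcs, so for undirected graphs DAG sets are the independent sets); $\delta(G)$ is the size of the largest DAG set in $G$.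 Orthogonal partitions: let $s\ge k\ge 1$. A set $\mathcal M$ of $k\times s$ matrices over $\mathbb N$ is a family of orthogonal partitions of $\{1,\dots,ks\}$ of shape $(k,s)$ if (1) every $A\in\mathcal M$ contains every element of $\{1,\dots,ks\}$ exactly once; (2) for all distinct $A,B\in\mathcal M$, every column of $A$ has common entries with exactly $k$ columns of $B$, and every such pair of intersecting columns has exactly one common element. Interleaved graph: fix a coloring $c(\cdot)$ of $V$ with colors $1,\dots,c$ such that adjacent vertices have different colors, and distinct matrices $M_1,\dots,M_c\in\mathcal M$. The graph $\bar G=(\bar V,\bar E)$ has $\bar V=\{1,\dots,n\}\times\{1,\dots,s\}$ and $((t,\mu),(t',\mu'))\in\bar E$ if and only if $(t,t')\in E$ and column $\mu$ of $M_{c(t)}$ intersects column $\mu'$ of $M_{c(t')}$ (as sets of entries). Interleaved code: for any (not necessarily distinct) $x^1,\dots,x^{ks}\in\mathcal C$, let $\bar x\in (Q^k)^{\bar V}$ be the word that assigns to the vertex $(t,\mu)$ the vector $\bigl(x_t^{M_{c(t)}(1,\mu)},\dots,x_t^{M_{c(t)}(k,\mu)}\bigr)\in Q^k$. The code $\bar{\mathcal C}$ (over the alphabet $Q^k$) is the set of all words $\bar x$ obtained as $(x^1,\dots,x^{ks})$ ranges over $\mathcal C^{ks}$. *)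

(* Defs.v *)
From mathcomp Require Import all_boot all_order all_algebra.
From mathcomp Require Import finmap.
From mathcomp Require Import all_classical all_reals all_analysis.

Set Implicit Arguments.
Unset Strict Implicit.
Unset Printing Implicit Defensive.

Import Order.TTheory GRing.Theory Num.Theory.
Local Open Scope ring_scope.

(* A graph is an arc relation [E] on a finite type of vertices.  An undirected
   graph is a symmetric [E]: each edge is a pair of opposite arcs. *)

Section StorageCodes.
Variables (V : finType) (E : rel V).

(* The recovery function at [v] reads the coordinates in N(v) = {u | E v u}. *)
Definition storage_code (Q : finType) (C : {set {ffun V -> Q}}) : Prop :=
  C != finset.set0 /\
  forall v : V, exists f : {ffun {u : V | E v u} -> Q} -> Q,
    forall x : {ffun V -> Q}, x \in C -> x v = f [ffun u => x (val u)].

(* A cycle of length two, i.e. a pair of opposite arcs, counts as a directed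
   cycle, so for symmetric loopless [E] these are the independent sets. *)
Definition dag_set (S : {set V}) : Prop :=
  forall c : seq V, c != [::] -> {subset c <= S} -> ~ ucycle E c.

Definition delta : nat := \max_(S : {set V} | `[< dag_set S >]) #|S|.

End StorageCodes.

Definition rate (R : realType) (q : nat) (V Q : finType)
    (C : {set {ffun V -> Q}}) : R :=
  #|V|%:R^-1 * (ln #|C|%:R / ln q%:R).

(* For fixed [q] only finitely many rates occur, so this supremum is a
   maximum whenever [q > 0]. *)
Definition capq (R : realType) (q : nat) (V : finType) (E : rel V) : R :=
  sup [set r : R | exists (Q : finType) (C : {set {ffun V -> Q}}),
         [/\ #|Q| = q, storage_code E C & r = rate R q C]]%classic.

Definition cap (R : realType) (V : finType) (E : rel V) : R :=
  sup [set capq R q E | q in [set q : nat | (2 <= q)%N]]%classic.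

Section OrthogonalPartitions.
Variables (k s : nat).

Definition column (A : 'M[nat]_(k, s)) (mu : 'I_s) : {fset nat} :=
  [fset A i mu | i : 'I_k]%fset.

Definition columns_meet (A B : 'M[nat]_(k, s)) (mu nu : 'I_s) : bool :=
  (column A mu `&` column B nu != fset0)%fset.

Definition orthogonal_partitions (M : set 'M[nat]_(k, s)) : Prop :=
  (forall A, M A -> forall j : nat, (1 <= j <= k * s)%N ->
     #|[set p : 'I_k * 'I_s | A p.1 p.2 == j]%SET| = 1%N) /\
  (forall A B, M A -> M B -> A <> B ->
     (forall mu : 'I_s, #|[set nu : 'I_s | columns_meet A B mu nu]%SET| = k) /\
     (forall mu nu : 'I_s, columns_meet A B mu nu ->
        #|` (column A mu `&` column B nu)%fset| = 1%N)).

End OrthogonalPartitions.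

Section Interleaving.
Variables (n k s c : nat) (E : rel 'I_n).
Variables (col : 'I_n -> 'I_c) (M : 'I_c -> 'M[nat]_(k, s)).

Definition interleaved_graph : rel ('I_n * 'I_s) := fun p p' =>
  E p.1 p'.1 && columns_meet (M (col p.1)) (M (col p'.1)) p.2 p'.2.

Variables (Q : finType).

Definition interleaved_word (x : nat -> {ffun 'I_n -> Q}) :
    {ffun 'I_n * 'I_s -> {ffun 'I_k -> Q}} :=
  [ffun p => [ffun i => x (M (col p.1) i p.2) p.1]].

(* The codewords x^1, ..., x^(ks) are given as a sequence of which only the
   terms of index 1, ..., ks matter, the matrix entries being in this range. *)
Definition interleaved_code (C : {set {ffun 'I_n -> Q}}) :
    {set {ffun 'I_n * 'I_s -> {ffun 'I_k -> Q}}} :=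
  [set y | `[< exists x : nat -> {ffun 'I_n -> Q},
      (forall j : nat, (1 <= j <= k * s)%N -> x j \in C) /\
      y = interleaved_word x >]]%SET.

End Interleaving.

(* Main.v *)
(* If S is a DAG set, the coordinates of a codeword outside S determine it, so
   every storage code has rate at most 1 - delta/n over every alphabet. In the
   interleaved graph, S x {1, ..., s} is again a DAG set, so its capacity is at
   most 1 - s delta/(n s) = 1 - delta/n. Each index j in {1, ..., k s} occurs
   exactly once in each matrix, so the interleaved code encodes C^(k s)
   bijectively and recovers each x^j separately: it has the rate of C, which
   attains the bound. *)

Require Import Defs.
From mathcomp Require Import all_boot all_order all_algebra.
From mathcomp Require Import finmap.
From mathcomp Require Import all_classical all_reals all_analysis.

Set Implicit Arguments.
Unset Strict Implicit.
Unset Printing Implicit Defensive.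

Import Order.TTheory GRing.Theory Num.Theory.
Local Open Scope ring_scope.

(** * Directed cycles, DAG sets and the size of storage codes *)

Section Graphs.
Variables (V : finType) (E : rel V).

(** Choosing an out-neighbour in [D] for each vertex gives a self-map [g] of [D], whose iterates
    from any vertex end in a periodic orbit; this orbit is the cycle. *)
Lemma ucycle_of_outdegree (D : {set V}) :
  D != finset.set0 -> (forall v, v \in D -> exists2 u, u \in D & E v u) ->
  exists c : seq V, [/\ c != [::], {subset c <= D} & ucycle E c].
Proof.
case/set0Pn => v0 Dv0 outD.
pose g v := odflt v [pick u in D | E v u].
have gP v : v \in D -> (g v \in D) && E v (g v).
  move=> Dv; rewrite /g; case: pickP => [u //|noD] /=.
  by have [u Du Evu] := outD v Dv; have := noD u; rewrite Du Evu.
have iter_in v i : v \in D -> iter i g v \in D.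
  by move=> Dv; elim: i => //= i /gP/andP[].
have /trajectP[i lt_i eq_i] := looping_order g v0.
pose y := iter i g v0.
have y_per : exists m, iter m.+1 g y = y.
  (* The iterate of order [order g v0] equals the earlier [i]-th one, so their difference is a
     period of [y]. *)
  exists (order g v0 - i).-1%N.
  by rewrite prednK ?subn_gt0// -iterD subnK ?eq_i// ltnW.
have orbD : {subset orbit g y <= D}.
  by move=> z /trajectP[j _ ->]; exact/iter_in/iter_in.
exists (orbit g y); split=> //.
  by rewrite -size_eq0 size_orbit -lt0n order_gt0.
rewrite /ucycle orbit_uniq andbT.
apply: (sub_in_cycle (P := mem D) (e := frel g)).
- by move=> u v Du _ /eqP <-; have /andP[] := gP u Du.
- by apply/allP => z /orbD.
- by apply/(orbitPcycle 3 0).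
Qed.

(** [dag_set] only forbids cycles without repeated vertices, but projecting a cycle can create
    repetitions. Each vertex of a closed walk has a successor in it, so the walk contains a simple
    cycle. *)
Lemma dag_set_no_cycle (S : {set V}) :
  dag_set E S -> forall c : seq V, c != [::] -> {subset c <= S} -> ~ cycle E c.
Proof.
move=> dagS c c_neq0 cS cycle_c.
have c0 : [set v in c]%SET != finset.set0.
  case: c c_neq0 {cS cycle_c} => // v c _; apply/set0Pn.
  by exists v; rewrite !inE eqxx.
case: (ucycle_of_outdegree c0) => [v|c' [c'_neq0 c'c uc']].
  rewrite inE => cv; exists (next c v); first by rewrite inE mem_next.
  exact: next_cycle.
by apply: (dagS c' _ _ uc') => // v /c'c; rewrite inE => /cS.
Qed.

Lemma dag_set_leq_delta (S : {set V}) : dag_set E S -> (#|S| <= delta E)%N.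
Proof. by move=> dagS; apply: leq_bigmax_cond; apply/asboolP. Qed.

Lemma exists_dag_set_delta : exists2 S : {set V}, dag_set E S & #|S| = delta E.
Proof.
have dag0 : `[< dag_set E finset.set0 >].
  apply/asboolP => -[//|v c] _ /(_ v (mem_head _ _)).
  by rewrite inE.
have [|S /asboolP dagS eqS] :=
  @eq_bigmax_cond _ (fun S : {set V} => `[< dag_set E S >]) (fun S => #|S|).
  by apply/card_gt0P; exists finset.set0.
by exists S.
Qed.

Variable Q : finType.
Implicit Type C : {set {ffun V -> Q}}.

Lemma storage_code_eq C : storage_code E C -> forall x y v, x \in C -> y \in C ->
  (forall u, E v u -> x u = y u) -> x v = y v.
Proof.
move=> [_ recC] x y v Cx Cy eqxy; have [f fP] := recC v.
rewrite (fP x)// (fP y)//; congr f.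
by apply/ffunP => u; rewrite !ffunE; apply/eqxy/valP.
Qed.

(** To recover the symbol at [v], pick any codeword with the given neighbour values and read it at
    [v]; [x0] serves for values that no codeword takes. *)
Lemma storage_code_intro C : C != finset.set0 ->
  (forall x y v, x \in C -> y \in C ->
     (forall u, E v u -> x u = y u) -> x v = y v) ->
  storage_code E C.
Proof.
move=> C_neq0 detC; split=> // v; have /set0Pn[x0 Cx0] := C_neq0.
pose nb (x : {ffun V -> Q}) : {ffun {u : V | E v u} -> Q} := [ffun u => x (val u)].
exists (fun w => odflt x0 [pick x in C | nb x == w] v) => x Cx.
case: pickP => [y /andP[Cy /eqP eqy]|/(_ x)]; last by rewrite Cx eqxx.
apply: detC => // u Evu.
by move/ffunP/(_ (Sub u Evu)): eqy; rewrite !ffunE.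
Qed.

(* The disagreement set of two codewords equal off S lies in S, and each of its
   vertices has an out-neighbour in it. *)
Lemma storage_code_inj_off_dag C (S : {set V}) (x y : {ffun V -> Q}) :
  storage_code E C -> dag_set E S -> x \in C -> y \in C ->
  (forall v, v \notin S -> x v = y v) -> x = y.
Proof.
move=> codeC dagS Cx Cy eq_off.
pose D := [set v | x v != y v]%SET.
have [D0|Dn0] := eqVneq D finset.set0.
  apply/ffunP => v; apply/eqP; apply: contraT => nxy.
  by have : v \in D by [rewrite inE]; rewrite D0 inE.
have DS v : v \in D -> v \in S.
  by rewrite inE; apply: contraR => /eq_off ->.
case: (ucycle_of_outdegree Dn0) => [v|c [c_neq0 cD uc]].
  rewrite inE => nxy.
  have [u /andP[Evu Du]|noD] := pickP (fun u => E v u && (u \in D)); first by exists u.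
  case/eqP: nxy; apply: (storage_code_eq codeC) => // u Evu.
  by have := noD u; rewrite Evu inE /= => /negbFE/eqP.
by case: (dagS c c_neq0 _ uc) => v /cD/DS.
Qed.

(** Restriction to the complement of [S] is injective on [C]. The product form avoids a subtraction
    in the exponent. *)
Lemma card_storage_code C (S : {set V}) : storage_code E C -> dag_set E S ->
  (#|C| * #|Q| ^ #|S| <= #|Q| ^ #|V|)%N.
Proof.
move=> codeC dagS.
pose r (x : {ffun V -> Q}) : {ffun {v : V | v \notin S} -> Q} := [ffun v => x (val v)].
have rinj : {in C &, injective r}.
  move=> x y Cx Cy /ffunP eqr; apply: (storage_code_inj_off_dag codeC dagS) => // v Sv.
  by have := eqr (Sub v Sv); rewrite !ffunE.
have := leq_card_in r (mem C) rinj; rewrite card_ffun card_sig => leC.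
apply: (leq_trans (leq_mul leC (leqnn _))).
rewrite -expnD -(cardC (mem S)) addnC leq_eqVlt; apply/orP; left.
by apply/eqP; congr (_ ^ (_ + _))%N; apply: eq_card => v; rewrite !inE.
Qed.

End Graphs.

(** * The DAG bound on rates and capacities *)

Section Capacity.
Variables (R : realType) (V : finType) (E : rel V).
Hypothesis V_gt0 : (0 < #|V|)%N.

Lemma rate_le_delta q (Q : finType) (C : {set {ffun V -> Q}}) :
  (2 <= q)%N -> #|Q| = q -> storage_code E C ->
  rate R q C <= 1 - (delta E)%:R / #|V|%:R.
Proof.
move=> q_ge2 card_Q codeC.
have [S dagS <-] := exists_dag_set_delta E.
have lnq : 0 < ln q%:R :> R by rewrite ln_gt0// ltr1n.
have q0 : 0 < q%:R :> R by rewrite ltr0n ltnW.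
have C0 : 0 < #|C|%:R :> R by rewrite ltr0n card_gt0; case: codeC.
have V0 : 0 < #|V|%:R :> R by rewrite ltr0n.
have lnC : ln #|C|%:R <= (#|V|%:R - #|S|%:R) * ln q%:R :> R.
  have := card_storage_code codeC dagS; rewrite card_Q -(ler_nat R) natrM !natrX.
  rewrite -[X in is_true X -> _]ler_ln ?posrE ?mulr_gt0 ?exprn_gt0//.
  rewrite lnM ?posrE ?exprn_gt0// !lnXn// -!(mulr_natl (ln _)).
  by rewrite mulrBl lerBrDr.
rewrite /rate mulrC ler_pdivrMr// mulrBl mul1r divfK ?gt_eqF//.
by rewrite ler_pdivrMr.
Qed.

Lemma capq_le_delta q : (2 <= q)%N -> capq R q E <= 1 - (delta E)%:R / #|V|%:R.
Proof.
move=> q_ge2; apply: ge_sup; last first.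
  by move=> r [Q [C [card_Q codeC ->]]]; apply: rate_le_delta.
(* The one-word code shows that the set of rates is nonempty, as a bound on its supremum
   requires. *)
pose w : {ffun V -> 'I_q} := [ffun=> Ordinal (ltnW q_ge2)].
exists (rate R q (finset.set1 w)); exists 'I_q, (finset.set1 w); split=> //.
  exact: card_ord.
apply: storage_code_intro; first by apply/set0Pn; exists w; rewrite inE.
by move=> x y v; rewrite !inE => /eqP-> /eqP->.
Qed.

Lemma rate_le_capq q (Q : finType) (C : {set {ffun V -> Q}}) :
  (2 <= q)%N -> #|Q| = q -> storage_code E C -> rate R q C <= capq R q E.
Proof.
move=> q_ge2 card_Q codeC; apply: ub_le_sup; last by exists Q, C.
(* A supremum dominates its set only if the set is bounded above; the DAG bound ensures this. *)
exists (1 - (delta E)%:R / #|V|%:R) => r [Q' [C' [card_Q' codeC' ->]]].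
exact: rate_le_delta.
Qed.

Lemma cap_le_delta : cap R E <= 1 - (delta E)%:R / #|V|%:R.
Proof.
apply: ge_sup; first by exists (capq R 2 E), 2%N.
by move=> r [q /= q_ge2 <-]; apply: capq_le_delta.
Qed.

Lemma capq_le_cap q : (2 <= q)%N -> capq R q E <= cap R E.
Proof.
move=> q_ge2; apply: ub_le_sup; last by exists q.
exists (1 - (delta E)%:R / #|V|%:R) => r [q' /= q'_ge2 <-].
exact: capq_le_delta.
Qed.

End Capacity.

(** * Entries of the matrices *)

Lemma orthogonal_partitions_entry k s (MM : set 'M[nat]_(k, s)) A j :
  orthogonal_partitions MM -> MM A -> (1 <= j <= k * s)%N ->
  exists i mu, A i mu = j.
Proof.
move=> [MM1 _] MA /(MM1 _ MA) card1.
have /card_gt0P[[i mu]] : (0 < #|[set p : 'I_k * 'I_s | A p.1 p.2 == j]%SET|)%N by rewrite card1.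
by rewrite inE => /eqP; exists i, mu.
Qed.

(* Each of the k s values is taken at one of the k s positions, so no other
   value is. *)
Lemma orthogonal_partitions_range k s (MM : set 'M[nat]_(k, s)) A i mu :
  orthogonal_partitions MM -> MM A -> (1 <= A i mu <= k * s)%N.
Proof.
move=> MM_orth MA.
have pos (j : 'I_(k * s)) : {p : 'I_k * 'I_s | A p.1 p.2 = j.+1}.
  apply: cid; have [|i' [mu' eqA]] := @orthogonal_partitions_entry _ _ _ A j.+1 MM_orth MA.
    by rewrite /= ltn_ord.
  by exists (i', mu').
pose g j := sval (pos j).
have g_inj : injective g.
  move=> j j' eqg; apply/val_inj/succn_inj.
  by rewrite -(svalP (pos j)) -(svalP (pos j')) -/(g j) eqg.
have [|h _ gK] := inj_card_bij g_inj.
  by rewrite card_prod !card_ord.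
by rewrite -[i]/((i, mu).1) -[mu]/((i, mu).2) -(gK (i, mu)) (svalP (pos _)) /= ltn_ord.
Qed.

Lemma columns_meet_entry k s (A B : 'M[nat]_(k, s)) i mu i' mu' :
  A i mu = B i' mu' -> columns_meet A B mu mu'.
Proof.
move=> eqAB; apply/fset0Pn; exists (A i mu); rewrite in_fsetI.
apply/andP; split; last rewrite eqAB.
  by apply/imfsetP; exists i.
by apply/imfsetP; exists i'.
Qed.

(** * The interleaved graph and code *)

Section Interleaving.
Variables (n k s c : nat) (E : rel 'I_n).
Variables (col : 'I_n -> 'I_c) (M : 'I_c -> 'M[nat]_(k, s)).
Variables (MM : set 'M[nat]_(k, s)) (MM_orth : orthogonal_partitions MM).
Hypothesis M_in : forall a : 'I_c, MM (M a).
Let Ebar := interleaved_graph E col M.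

(* The witness is S x {1, ..., s} for a maximum DAG set S of G: cycles of the
   interleaved graph project to closed walks of G. *)
Lemma delta_interleaved_graph : (delta E * s <= delta Ebar)%N.
Proof.
have [S dagS <-] := exists_dag_set_delta E.
have -> : (#|S| * s)%N = #|finset.setX S [set: 'I_s]%SET|.
  by rewrite cardsX cardsT card_ord.
apply: dag_set_leq_delta => p p_neq0 pS /andP[cycle_p _].
apply: (dag_set_no_cycle dagS (c := map fst p)).
- by case: p p_neq0 {pS cycle_p}.
- by move=> t /mapP[u /pS]; rewrite inE => /andP[Su _] ->.
- rewrite cycle_map; apply: sub_cycle cycle_p.
  by move=> u v /andP[].
Qed.

Variables (Q : finType) (C : {set {ffun 'I_n -> Q}}).
Let Cbar := interleaved_code col M C.

Lemma interleaved_codeP y : reflect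
  (exists2 x : nat -> {ffun 'I_n -> Q},
     forall j, (1 <= j <= k * s)%N -> x j \in C & y = interleaved_word col M x)
  (y \in Cbar).
Proof.
rewrite inE; apply: (iffP (asboolP _)) => [[x [Cx ->]]|[x Cx ->]]; first by exists x.
by exists x.
Qed.

(** All entries lie in the range, so other indices do not affect the word; every index of the range
    occurs in the matrix of each color, so the word reveals each coordinate of the codeword with
    that index. *)
Lemma eq_interleaved_word (x y : nat -> {ffun 'I_n -> Q}) :
  (forall j, (1 <= j <= k * s)%N -> x j = y j) <->
  interleaved_word col M x = interleaved_word col M y.
Proof.
split=> [eqxy|/ffunP eqw j jP].
  apply/ffunP => p; apply/ffunP => i; rewrite !ffunE eqxy//.
  exact: (orthogonal_partitions_range _ _ MM_orth).
apply/ffunP => t.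
have [i [mu eqj]] := orthogonal_partitions_entry MM_orth (M_in (col t)) jP.
by move: (eqw (t, mu)) => /ffunP/(_ i); rewrite !ffunE /= eqj.
Qed.

Lemma card_interleaved_code : C != finset.set0 -> #|Cbar| = (#|C| ^ (k * s))%N.
Proof.
case/set0Pn=> x0 _.
(* The ordinal [o] stands for the index [o.+1]; the values at 0 and above [k * s] are arbitrary. *)
pose word (f : {ffun 'I_(k * s) -> {ffun 'I_n -> Q}}) :=
  interleaved_word col M (fun j => if insub j.-1 is Some o then f o else x0).
have wordE (f : {ffun 'I_(k * s) -> {ffun 'I_n -> Q}}) (o : 'I_(k * s)) :
    (if insub o.+1.-1 is Some o then f o else x0) = f o.
  by rewrite valK.
rewrite -[X in (_ ^ X)%N]card_ord -card_ffun_on.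
have word_inj : injective word.
  move=> f g /eq_interleaved_word eqfg; apply/ffunP => o.
  by have := eqfg o.+1 (ltn_ord o); rewrite !wordE.
rewrite -(card_imset _ word_inj); apply: eq_card => y.
apply/interleaved_codeP/imsetP => [[x Cx ->]|[f /ffun_onP Cf ->]].
  exists [ffun o : 'I_(k * s) => x o.+1].
    by apply/ffun_onP => o; rewrite ffunE Cx/=.
  apply/eq_interleaved_word => -[//|j] jks.
  by rewrite insubT ffunE.
eexists; last by [].
by move=> [//|j] jks; rewrite insubT; apply: Cf.
Qed.

Hypothesis C_code : storage_code E C.

(** A symbol at [(t, mu)] belongs to the codeword of some index [j]. For each out-neighbour [u] of
    [t], the column of [M (col u)] containing [j] gives an out-neighbour of [(t, mu)] that stores
    the symbol of that codeword at [u]. Recovery in [C] then applies. *)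
Lemma interleaved_storage_code : storage_code Ebar Cbar.
Proof.
have [C_neq0 _] := C_code; apply: storage_code_intro.
  by rewrite -card_gt0 card_interleaved_code// expn_gt0 card_gt0 C_neq0.
move=> _ _ [t mu] /interleaved_codeP[x Cx ->] /interleaved_codeP[y Cy ->] eqxy.
apply/ffunP => i; rewrite !ffunE /=.
have jP := orthogonal_partitions_range i mu MM_orth (M_in (col t)).
apply: (storage_code_eq C_code); [exact: Cx|exact: Cy|move=> u Etu].
have [i' [mu' eqj]] := orthogonal_partitions_entry MM_orth (M_in (col u)) jP.
have /ffunP/(_ i') : interleaved_word col M x (u, mu') = interleaved_word col M y (u, mu').
  by apply: eqxy; rewrite /Ebar /interleaved_graph /= Etu; apply: (columns_meet_entry (esym eqj)).
by rewrite !ffunE /= eqj.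
Qed.

(** In the logarithm of the code size the exponent [k * s] cancels the factor [k] from the alphabet
    and the factor [s] from the number of vertices. *)
Lemma rate_interleaved_code (R : realType) q : (0 < k)%N -> (0 < s)%N ->
  (2 <= q)%N -> rate R (q ^ k) Cbar = rate R q C.
Proof.
move=> k0 s0 q2; have [C_neq0 _] := C_code.
have C0 : 0 < #|C|%:R :> R by rewrite ltr0n card_gt0.
rewrite /rate card_interleaved_code// card_prod !card_ord !natrX.
have q0 : 0 < q%:R :> R by rewrite ltr0n ltnW.
have kn : k%:R != 0 :> R by rewrite pnatr_eq0 -lt0n.
have sn : s%:R != 0 :> R by rewrite pnatr_eq0 -lt0n.
rewrite !lnXn// -!(mulr_natl (ln _)) !natrM -(mulrA k%:R) -mulf_div divff// mul1r.
by rewrite invfM !mulrA mulfVK.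
Qed.

End Interleaving.

Theorem proposition3p4 (R : realType) (n : nat) (n_gt0 : (0 < n)%N)
    (E : rel 'I_n) (E_loopless : irreflexive E)
    (q : nat) (q_ge2 : (2 <= q)%N) (Q : finType) (card_Q : #|Q| = q)
    (C : {set {ffun 'I_n -> Q}}) (C_code : storage_code E C)
    (C_opt : rate R q C = capq R q E)
    (k s : nat) (k_ge1 : (1 <= k)%N) (k_le_s : (k <= s)%N)
    (MM : set 'M[nat]_(k, s)) (MM_orth : orthogonal_partitions MM)
    (c : nat) (col : 'I_n -> 'I_c)
    (col_proper : forall u v : 'I_n, E u v -> col u <> col v)
    (M : 'I_c -> 'M[nat]_(k, s)) (M_in : forall a : 'I_c, MM (M a))
    (M_inj : injective M)
    (cap_delta : capq R q E = 1 - (delta E)%:R / n%:R) :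
  let Ebar := interleaved_graph E col M in
  let Cbar := interleaved_code col M C in
  [/\ storage_code Ebar Cbar,
      rate R (q ^ k)%N Cbar = cap R Ebar
    & capq R (q ^ k)%N Ebar = cap R E].
Proof.
move=> Ebar Cbar.
have s_gt0 : (0 < s)%N := leq_trans k_ge1 k_le_s.
have codeCbar : storage_code Ebar Cbar := interleaved_storage_code col MM_orth M_in C_code.
have qk_ge2 : (2 <= q ^ k)%N.
  by rewrite (leq_trans q_ge2)// -{1}(expn1 q) leq_pexp2l// ltnW.
have card_Qk : #|{ffun 'I_k -> Q}| = (q ^ k)%N by rewrite card_ffun card_ord card_Q.
have V_gt0 : (0 < #|'I_n|)%N by rewrite card_ord.
have Vbar_gt0 : (0 < #|{: 'I_n * 'I_s}|)%N by rewrite card_prod !card_ord muln_gt0 n_gt0.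
have rateCbar : rate R (q ^ k) Cbar = 1 - (delta E)%:R / n%:R.
  by rewrite (rate_interleaved_code col MM_orth M_in C_code)// C_opt.
have capEbar_le : cap R Ebar <= 1 - (delta E)%:R / n%:R.
  apply: (le_trans (cap_le_delta R Ebar Vbar_gt0)).
  rewrite card_prod !card_ord lerD2l lerN2 natrM.
  rewrite ler_pdivlMr ?mulr_gt0 ?ltr0n// mulrA divfK ?pnatr_eq0 -?lt0n//.
  by rewrite -natrM ler_nat delta_interleaved_graph.
have le1 := rate_le_capq R Vbar_gt0 qk_ge2 card_Qk codeCbar.
have le2 := capq_le_cap R Ebar Vbar_gt0 qk_ge2.
(* The capacity of [E] lies between [capq R q E] and the DAG bound, which agree by hypothesis. *)
have capE : cap R E = 1 - (delta E)%:R / n%:R.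
  apply/eqP; rewrite eq_le -{2}cap_delta capq_le_cap// andbT.
  by have := cap_le_delta R E V_gt0; rewrite card_ord.
(* The chain from the rate of [Cbar] through [capq] and [cap] of [Ebar] up to the DAG bound has
   equal ends, so it collapses. *)
rewrite rateCbar in le1 *; split=> //; apply/eqP; rewrite eq_le.
  by rewrite (le_trans le1).
by rewrite capE le1 (le_trans le2).
Qed.
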